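(* For any $k\in\mathbb{N}$, $k\ge 2$, the mechanical system in the plane $\mathbb{C}$ with the flat metric and force function $U(q)=1/|q|^{2-2/k}$, restricted to its zero-energy surface, admits a 5-parameter family of smooth integrable reflection walls without ruling out the scalings and the rotations, and a 3-parameter family of smooth integrable reflection walls when ruling out the scalings and the rotations (i.e. when curves which differ only by scalings and rotations are identified).
   Context: The mechanical system with force function $U$ in the plane with the flat metric has Hamiltonian (energy) $E=\frac{|p|^2}{2}-U(q)$. For a curve $\mathcal{B}$, the mechanical billiard restricted to $\{E=e\}$ consists of the motions with energy $e$, reflected elastically at $\mathcal{B}$ (tangential component of the momentum kept, normal component reversed). $\mathcal{B}$ is called an integrable reflection wall at energy $e$ if there is an additional non-trivial (independent of $E$) first integral defined on $\{E=e\}$, preserved by the motion and by the reflections at $\mathcal{B}$. It is not required that the billiard mapping be always well-defined. Reflection walls here may be immersed curves with self-intersections obtained as images of curves in a source plane under $z\mapsto q=z^k$; in this case the law of reflection is that the particle is reflected at the curve when the corresponding motion in the source plane (lifted through $z\mapsto z^k$) is reflected at the source curve, and otherwise it simply crosses the curve. *)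

(* Defs.v *)
From HB Require Import structures.
From mathcomp Require Import all_boot all_order all_algebra.
From mathcomp Require Import all_classical all_reals all_analysis.

Set Implicit Arguments.
Unset Strict Implicit.
Unset Printing Implicit Defensive.

Import Order.TTheory GRing.Theory Num.Theory.
Import numFieldNormedType.Exports.

Local Open Scope classical_set_scope.
Local Open Scope ring_scope.

Section Smooth.
Context {R : realType}.

(* [Cn n O f]: f is of class C^n on the open set O.  The recursion goes through
   all directional derivatives; on finite-dimensional spaces (the only ones used
   here) this is the usual notion. *)
Fixpoint Cn (n : nat) {V W : normedModType R} (O : set V) (f : V -> W) : Prop :=
  match n with
  | 0 => forall x, O x -> {for x, continuous f}
  | n'.+1 => (forall x, O x -> differentiable f x) /\
             (forall v : V, Cn n' O (fun x => 'D_v f x))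
  end.

Definition smooth {V W : normedModType R} (O : set V) (f : V -> W) : Prop :=
  forall n, Cn n O f.

End Smooth.

(* The plane C, the pair (x, y) standing for x + i y.  The norm that the library
   puts on R * R is the sup norm, which matters only through its topology; the
   metric of the mechanical system is given by [dot] and [enorm]. *)
Notation plane R := (R * R)%type (only parsing).

Section Plane.
Context {R : realType}.

Definition dot (u v : plane R) : R := u.1 * v.1 + u.2 * v.2.

Definition enorm (u : plane R) : R := Num.sqrt (dot u u).

Definition cmul (u v : plane R) : plane R :=
  (u.1 * v.1 - u.2 * v.2, u.1 * v.2 + u.2 * v.1).

Definition cpow (k : nat) (z : plane R) : plane R := iter k (cmul z) (1, 0).

Definition similitude (rho theta : R) (q : plane R) : plane R :=
  rho *: cmul (cos theta, sin theta) q.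

(* Equality up to scalings and rotations centered at the origin. *)
Definition same_up_to_similitude (A B : set (plane R)) : Prop :=
  exists rho theta : R, 0 < rho /\ B = similitude rho theta @` A.

Definition reflect_along (tau p : plane R) : plane R :=
  (2 * dot p tau / dot tau tau) *: tau - p.

End Plane.

Section Mechanics.
Context {R : realType}.
Implicit Types (U : plane R -> R) (e : R) (k : nat).

Definition energy U (q p : plane R) : R := dot p p / 2 - U q.

Definition gradient U (q : plane R) : plane R :=
  ('D_((1, 0) : plane R) U q, 'D_((0, 1) : plane R) U q).

(* Hamilton's equations of [energy U], for t in ]a, b[. *)
Definition motion U (a b : R) (q p : R -> plane R) : Prop :=
  forall t, t \in `]a, b[ ->
    is_derive t 1 q (p t) /\ is_derive t 1 p (gradient U (q t)).

(* Phase space lifted through z |-> q = z^k.  A point (z, p) consists of a point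
   z of the source plane and of the momentum p of the particle at q = z^k, so z
   records the particle together with the sheet on which it moves.  The origin,
   where z |-> z^k ramifies and where U may be singular, is removed. *)
Definition lifted_phase_space : set (plane R * plane R) :=
  [set x | x.1 != 0].

Definition lifted_energy U k (x : plane R * plane R) : R :=
  energy U (cpow k x.1) x.2.

Definition energy_surface U e k : set (plane R * plane R) :=
  lifted_phase_space `&` [set x | lifted_energy U k x = e].

(* As z |-> z^k is a local diffeomorphism away from 0, any continuous lift z of
   q is automatically differentiable. *)
Definition lifted_motion U e k (a b : R) (z p : R -> plane R) : Prop :=
  [/\ forall t, t \in `]a, b[ -> derivable z t 1,
      forall t, t \in `]a, b[ -> energy_surface U e k (z t, p t) &
      motion U a b (cpow k \o z) p].

Definition preserved_by_motion U e k (F : plane R * plane R -> R) : Prop :=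
  forall (a b : R) (z p : R -> plane R), lifted_motion U e k a b z p ->
    forall s t, s \in `]a, b[ -> t \in `]a, b[ -> F (z s, p s) = F (z t, p t).

(* Reflections take place exactly when z meets the source curve gamma; a
   particle whose lift is not on gamma crosses the wall.  The momentum is
   reflected in the q-plane, at the wall s |-> gamma(s)^k. *)
Definition preserved_by_reflections U e k (gamma : R -> plane R)
    (F : plane R * plane R -> R) : Prop :=
  forall (s : R) (p : plane R), energy_surface U e k (gamma s, p) ->
    F (gamma s, reflect_along ('D_1 (cpow k \o gamma) s) p) = F (gamma s, p).

Definition independent_at (F G : plane R * plane R -> R)
    (x : plane R * plane R) : Prop :=
  forall a b : R,
    (forall v, a * 'd F x v + b * 'd G x v = 0) -> a = 0 /\ b = 0.

(* Independence from the energy is required on a dense subset of the energy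
   surface, so that F may not be constant on any part of it. *)
Definition first_integral U e k (gamma : R -> plane R)
    (F : plane R * plane R -> R) : Prop :=
  [/\ smooth lifted_phase_space F,
      preserved_by_motion U e k F,
      preserved_by_reflections U e k gamma F &
      energy_surface U e k `<=`
        closure (energy_surface U e k `&`
                 [set x | independent_at (lifted_energy U k) F x])].

(* A smooth immersed curve without end points: closed, or going to infinity in
   both directions. *)
Definition smooth_curve (gamma : R -> plane R) : Prop :=
  [/\ smooth [set: R] gamma,
      forall s, 'D_1 gamma s != 0 &
      (exists2 T : R, 0 < T & forall s, gamma (s + T) = gamma s) \/
      (enorm (gamma s) @[s --> +oo] --> +oo /\
       enorm (gamma s) @[s --> -oo] --> +oo)].

(* The wall B is a smooth immersed curve of the q-plane, the image under
   z |-> z^k of a smooth curve gamma of the source plane avoiding the origin. *)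
Definition integrable_wall U e k (B : R -> plane R) : Prop :=
  exists gamma : R -> plane R,
    [/\ smooth_curve gamma,
        forall s, gamma s != 0,
        B = cpow k \o gamma &
        exists F, first_integral U e k gamma F].

(* A smooth n-parameter family of integrable walls in which the walls, viewed as
   subsets of the plane, are pairwise distinct modulo the relation [same]. *)
Definition wall_family U e k (same : set (plane R) -> set (plane R) -> Prop)
    (n : nat) (P : set 'rV[R]_n) (B : 'rV[R]_n -> R -> plane R) : Prop :=
  [/\ open P /\ P !=set0,
      smooth (P `*` [set: R]) (fun x : 'rV[R]_n * R => B x.1 x.2),
      forall a, P a -> integrable_wall U e k (B a) &
      forall a b, P a -> P b -> same (range (B a)) (range (B b)) -> a = b].

End Mechanics.

Definition force_function {R : realType} (k : nat) (q : plane R) : R :=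
  1 / (enorm q `^ (2 - 2 / k%:R)).

(* Main.v *)
(* In the coordinate z with q = z^k, the zero-energy motions of the force
   function |q|^(2/k-2) are, up to a change of time, the straight lines of the
   z-plane, and z |-> z^k being conformal, the reflections correspond too.  The
   system is thus the free billiard of the z-plane, for which every ellipse is
   an integrable wall, thanks to Joachimsthal's integral.  The ellipses have 5
   parameters; scalings and rotations of the q-plane lift to scalings and
   rotations of the z-plane, which bring the center to 1 and leave 3 parameters.
   All ellipses considered lie in a thin sector around the positive real axis,
   where z |-> z^k is injective. *)

From HB Require Import structures.
Require Import Defs.
From mathcomp Require Import all_boot all_order all_algebra.
From mathcomp Require Import all_classical all_reals all_analysis.
From mathcomp Require Import ring lra.

Set Implicit Arguments.
Unset Strict Implicit.

Import Order.TTheory GRing.Theory Num.Theory.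
Import numFieldNormedType.Exports.

Local Open Scope classical_set_scope.
Local Open Scope ring_scope.

(** * Differentials and smoothness *)

Section Differential.
Context {R : realType}.

(** Ellipses are encoded by conjugate semi-axes (p, r) and (0, q) with p, q > 0 rather than by
    principal axes: this choice is unique and remains smooth at circles, where principal axes are
    undetermined. Joachimsthal's integral can be written with the same five numbers as a polynomial
    in (z, p), so its smoothness needs no case distinction. Two requirements shape the rest.
    Parameters have to be recovered from the wall as a subset of the q-plane, up to a complex factor
    in the second family. Such a factor has k roots, so no root is chosen: the factor in the z-plane
    is defined as a quotient of two points of the ellipses, and injectivity of z |-> z^k on products
    of two points shows that it serves for all points. Moreover, independence from the energy has to
    hold on a dense set. The criterion used fails when z is a focus or the free momentum bisects the
    lines from z to the foci; a small dilation of z leaves the first set and a small rotation of the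
    momentum the second, without leaving the zero-energy surface. *)

Lemma is_diff_fst (V W : normedModType R) (x : V * W) : is_diff x fst fst.
Proof.
have c : continuous (fst : V * W -> V) by move=> ?; exact: cvg_fst.
apply: DiffDef; first exact: linear_differentiable.
exact: (@diff_lin _ _ _ (fst : {linear (V * W)%type -> V})).
Qed.

Lemma is_diff_snd (V W : normedModType R) (x : V * W) : is_diff x snd snd.
Proof.
have c : continuous (snd : V * W -> W) by move=> ?; exact: cvg_snd.
apply: DiffDef; first exact: linear_differentiable.
exact: (@diff_lin _ _ _ (snd : {linear (V * W)%type -> W})).
Qed.

Lemma is_diff_coord m n (M : 'M[R]_(m, n)) i j :
  is_diff M (fun N : 'M[R]_(m, n) => N i j) (fun N => N i j).
Proof.
apply: DiffDef; first exact: differentiable_coord.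
pose f : 'M[R]_(m, n) -> R^o := fun N => N i j.
have lf : linear f by move=> a u v; rewrite /f !mxE.
pose Lf := GRing.isLinear.Build _ _ _ _ _ lf.
pose F : {linear 'M[R]_(m, n) -> R^o} := HB.pack f Lf.
exact: (@diff_lin _ _ _ F _ (@coord_continuous _ _ _ i j)).
Qed.

Lemma is_derive_diff (V W : normedModType R) (f df : V -> W) (x v : V) :
  is_diff x f df -> is_derive x v f (df v).
Proof.
move=> h; have d : differentiable f x by exact: ex_diff.
apply: DeriveDef; first exact: diff_derivable.
by rewrite deriveE// diff_val.
Qed.

Lemma is_derive1_is_diff (W : normedModType R) (f : R -> W) (t : R) (d : W) :
  is_derive t 1 f d -> is_diff t f ( *:%R^~ d).
Proof.
move=> h; rewrite -(derive_val (is_derive := h)) -derive1E.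
by apply: DiffDef; [apply/derivable1_diffP|apply: deriv1E]; exact: ex_derive.
Qed.

Lemma is_derive1_comp_diff (V W : normedModType R) (f : R -> V) (g dg : V -> W)
    (t : R) (df : V) :
  is_derive t 1 f df -> is_diff (f t) g dg -> is_derive t 1 (g \o f) (dg df).
Proof.
move=> hf hg; have d : differentiable f t by apply/derivable1_diffP; exact: ex_derive.
have h : is_diff t f ('d f t) by exact: DiffDef.
have -> : dg df = (dg \o 'd f t) 1.
  by rewrite /= -deriveE// derive_val.
exact: is_derive_diff.
Qed.

Lemma is_derive1_pairP (V W : normedModType R) (f : R -> V * W) (t : R)
    (d : V * W) :
  is_derive t 1 f d <->
  is_derive t 1 (fst \o f) d.1 /\ is_derive t 1 (snd \o f) d.2.
Proof.
split=> [h|[h1 h2]].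
  by split; apply: is_derive1_comp_diff; [exact: is_diff_fst|exact: is_diff_snd].
have d1 : differentiable (fst \o f) t by apply/derivable1_diffP; exact: ex_derive.
have d2 : differentiable (snd \o f) t by apply/derivable1_diffP; exact: ex_derive.
have e : f = fun y => ((fst \o f) y, (snd \o f) y).
  by apply/funext => y /=; case: (f y).
rewrite e; apply: DeriveDef; first exact/derivable1_diffP/differentiable_pair.
rewrite deriveE; last exact: differentiable_pair.
rewrite diff_pair// -!deriveE//.
rewrite (@derive_val _ _ _ _ _ _ _ h1) (@derive_val _ _ _ _ _ _ _ h2).
by rewrite -surjective_pairing.
Qed.

(** A class closed under directional derivatives, to match the recursion of [Cn]. Inverses can be
    left out: the integral and the walls are polynomials in coordinates, cosines and sines. In
    [elementary_linear], being one's own differential everywhere stands for linear and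
    continuous. *)
Inductive elementary {V : normedModType R} : (V -> R) -> Prop :=
| elementary_cst c : elementary (fun=> c)
| elementary_linear f : (forall x, is_diff x f f) -> elementary f
| elementaryD f g : elementary f -> elementary g ->
    elementary (fun x => f x + g x)
| elementaryM f g : elementary f -> elementary g ->
    elementary (fun x => f x * g x)
| elementary_cos f : elementary f -> elementary (fun x => cos (f x))
| elementary_sin f : elementary f -> elementary (fun x => sin (f x)).

Lemma elementaryN {V : normedModType R} (f : V -> R) :
  elementary f -> elementary (fun x => - f x).
Proof.
move=> ef; rewrite (_ : (fun _ => _) = fun x => -1 * f x).
  by apply: elementaryM => //; exact: elementary_cst.
by apply/funext => x; rewrite mulN1r.
Qed.

Lemma elementaryB {V : normedModType R} (f g : V -> R) :
  elementary f -> elementary g -> elementary (fun x => f x - g x).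
Proof. by move=> ef eg; apply: elementaryD => //; exact: elementaryN. Qed.

Lemma elementaryX {V : normedModType R} (f : V -> R) n :
  elementary f -> elementary (fun x => f x ^+ n).
Proof.
move=> ef; elim: n => [|n ih]; first exact: elementary_cst.
rewrite (_ : (fun _ => _) = fun x => f x * f x ^+ n); first exact: elementaryM.
by apply/funext => x; rewrite exprS.
Qed.

(** For a fixed direction the derivative is again elementary, which is what lets the induction on
    the order of smoothness continue. *)
Lemma elementary_diff {V : normedModType R} (f : V -> R) : elementary f ->
  exists2 df : V -> V -> R,
    (forall x, is_diff x f (df x)) & (forall v, elementary (df^~ v)).
Proof.
elim=> {f} [c|f hf|f g _ [df hf ef] _ [dg hg eg]|f g Ef [df hf ef] Eg [dg hg eg]
           |f Ef [df hf ef]|f Ef [df hf ef]].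
- exists (fun _ _ => 0) => [x|v]; last exact: elementary_cst.
  exact: is_diff_cst.
- exists (fun _ => f) => // v; exact: elementary_cst.
- exists (fun x v => df x v + dg x v) => [x|v]; last exact: elementaryD.
  exact: is_diffD.
- exists (fun x v => f x * dg x v + g x * df x v) => [x|v].
    exact: is_diffM.
  by apply: elementaryD; apply: elementaryM.
- exists (fun x v => df x v * - sin (f x)) => [x|v].
    have h : is_diff (f x) cos ( *:%R^~ (- sin (f x))).
      exact: is_derive1_is_diff.
    exact: (is_diff_comp (hf x) h).
  by apply: elementaryM => //; apply/elementaryN/elementary_sin.
- exists (fun x v => df x v * cos (f x)) => [x|v].
    have h : is_diff (f x) sin ( *:%R^~ (cos (f x))).
      exact: is_derive1_is_diff.
    exact: (is_diff_comp (hf x) h).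
  by apply: elementaryM => //; apply/elementary_cos.
Qed.

Lemma elementary_differentiable {V : normedModType R} (f : V -> R) x :
  elementary f -> differentiable f x.
Proof. by case/elementary_diff => df hf _; exact: (ex_diff (is_diff_def := hf x)). Qed.

Lemma elementary_smooth {V : normedModType R} (O : set V) (f : V -> R) :
  elementary f -> smooth O f.
Proof.
move=> ef n; elim: n f ef => [|n ih] f ef /=.
  by move=> x _; exact/differentiable_continuous/elementary_differentiable.
split=> [x _|v]; first exact: elementary_differentiable.
have [df hf edf] := elementary_diff ef.
rewrite (_ : (fun _ => _) = df^~ v); first exact: ih.
by apply/funext => x; apply: derive_val; exact: is_derive_diff.
Qed.

Lemma elementary_smooth_pair {V : normedModType R} (O : set V) (f g : V -> R) :
  elementary f -> elementary g -> smooth O (fun x => (f x, g x)).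
Proof.
move=> ef eg n; elim: n f g ef eg => [|n ih] f g ef eg /=.
  move=> x _; apply/differentiable_continuous.
  by apply: differentiable_pair; exact: elementary_differentiable.
split=> [x _|v].
  by apply: differentiable_pair; exact: elementary_differentiable.
have [df hf edf] := elementary_diff ef.
have [dg hg edg] := elementary_diff eg.
rewrite (_ : (fun _ => _) = fun x => (df x v, dg x v)); first exact: ih.
apply/funext => x; apply: derive_val.
by apply: (@is_derive_diff _ _ _ (fun v => (df x v, dg x v))); exact: is_diff_pair.
Qed.

End Differential.

(** * Complex arithmetic in the plane *)

Section Complex.
Context {R : realType}.
Implicit Types (a b x y z : plane R) (s t r : R) (n k : nat).

Definition cconj z : plane R := (z.1, - z.2).

Definition cross a b : R := a.1 * b.2 - a.2 * b.1.

Lemma cmulC x y : cmul x y = cmul y x.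
Proof. by congr pair; ring. Qed.

Lemma cmulA x y z : cmul x (cmul y z) = cmul (cmul x y) z.
Proof. by rewrite /cmul /=; congr pair; ring. Qed.

Lemma cmul1 x : cmul (1, 0) x = x.
Proof. by case: x => a b; rewrite /cmul /=; congr pair; ring. Qed.

Lemma cmulDr x y z : cmul x (y + z) = cmul x y + cmul x z.
Proof. by rewrite /cmul; congr pair => /=; ring. Qed.

Lemma cmulACA x y z w : cmul (cmul x y) (cmul z w) = cmul (cmul x z) (cmul y w).
Proof. by rewrite /cmul /=; congr pair; ring. Qed.

Lemma cpowS n z : cpow n.+1 z = cmul z (cpow n z).
Proof. by []. Qed.

Lemma cpow_mul n x y : cpow n (cmul x y) = cmul (cpow n x) (cpow n y).
Proof.
elim: n => [|n ih]; first by rewrite cmul1.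
by rewrite !cpowS ih cmulACA.
Qed.

Lemma dot_cmul x y : dot (cmul x y) (cmul x y) = dot x x * dot y y.
Proof. by rewrite /dot /cmul /=; ring. Qed.

Lemma dot_cpow n z : dot (cpow n z) (cpow n z) = dot z z ^+ n.
Proof.
elim: n => [|n ih]; first by rewrite /dot /= expr0; ring.
by rewrite cpowS dot_cmul ih exprS.
Qed.

Lemma dot_ge0 z : 0 <= dot z z.
Proof. by rewrite /dot -!expr2 addr_ge0// sqr_ge0. Qed.

Lemma dot_eq0 z : (dot z z == 0) = (z == 0).
Proof.
case: z => u v; rewrite /dot /= -!expr2 paddr_eq0 ?sqr_ge0// !sqrf_eq0.
by apply/andP/eqP => [[/eqP-> /eqP->]//|[-> ->]]; rewrite eqxx.
Qed.

Lemma dot_gt0 z : (0 < dot z z) = (z != 0).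
Proof. by rewrite lt_neqAle dot_ge0 andbT eq_sym dot_eq0. Qed.

Lemma cmul_neq0 x y : x != 0 -> y != 0 -> cmul x y != 0.
Proof. by rewrite -!dot_gt0 dot_cmul; exact: mulr_gt0. Qed.

Lemma cpow_neq0 n z : z != 0 -> cpow n z != 0.
Proof. by rewrite -!dot_gt0 dot_cpow; exact: exprn_gt0. Qed.

Definition cinv z : plane R := ((dot z z)^-1 * z.1, (dot z z)^-1 * - z.2).

Lemma cmulV z : z != 0 -> cmul z (cinv z) = (1, 0).
Proof.
by rewrite -dot_eq0 /dot /cinv /cmul /dot /= => z0; congr pair; field; rewrite z0.
Qed.

Lemma cmul_inj z : z != 0 -> injective (cmul z).
Proof.
move=> z0 x y e; rewrite -[x]cmul1 -[y]cmul1 -(cmulV z0) (cmulC z).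
by rewrite -!cmulA e.
Qed.

Definition cone t z : Prop := 0 < z.1 /\ `|z.2| <= t * z.1.

Lemma cone_neq0 t z : cone t z -> z != 0.
Proof. by case=> h _; apply/eqP => z0; rewrite z0 /= ltxx in h. Qed.

Lemma cone_sub s t z : s <= t -> cone s z -> cone t z.
Proof.
move=> st [z0 h]; split=> //; apply: (le_trans h).
by rewrite ler_wpM2r// ltW.
Qed.

Lemma coneD t x y : cone t x -> cone t y -> cone t (x + y).
Proof.
move=> [x0 hx] [y0 hy]; split; first exact: addr_gt0.
by rewrite (le_trans (ler_normD _ _))//= mulrDr lerD.
Qed.

(** Arguments add under multiplication, and the slopes obey tan(a + b) = (s + t) / (1 - s t); the
    last numerical hypothesis is this bound cleared of its denominator. *)
Lemma cone_mul s t r x y : 0 <= s -> 0 <= t -> 0 <= r -> s * t < 1 ->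
  s + t <= r * (1 - s * t) -> cone s x -> cone t y -> cone r (cmul x y).
Proof.
case: x y => [x1 x2] [y1 y2] s0 t0 r0 st str [/= x0 hx] [/= y0 hy].
have xy0 : 0 < x1 * y1 by exact: mulr_gt0.
have h1 : x1 * y1 * (1 - s * t) <= x1 * y1 - x2 * y2.
  have : x2 * y2 <= (s * x1) * (t * y1).
    by rewrite (le_trans (ler_norm _))// normrM ler_pM.
  by lra.
split => /=; first by apply: lt_le_trans h1; rewrite mulr_gt0// subr_gt0.
apply: le_trans (_ : (s + t) * (x1 * y1) <= _).
  rewrite (le_trans (ler_normD _ _))// !normrM !(gtr0_norm x0, gtr0_norm y0).
  have : x1 * `|y2| <= x1 * (t * y1) by rewrite ler_wpM2l// ltW.
  have : `|x2| * y1 <= (s * x1) * y1 by rewrite ler_wpM2r// ltW.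
  by lra.
apply: le_trans (_ : r * (1 - s * t) * (x1 * y1) <= _).
  by rewrite ler_wpM2r// ltW.
by rewrite -mulrA ler_wpM2l// mulrC.
Qed.

(* [cone t] is the sector |arg z| <= arctan t.  The quotient of x^k - y^k by
   x - y is a sum of products of k - 1 factors x or y, so it stays in a sector
   contained in the half-plane 0 < Re, and in particular does not vanish. *)
Lemma cpow_inj_cone k x y : (0 < k)%N ->
  cone (2 * k%:R + 2)^-1 x -> cone (2 * k%:R + 2)^-1 y ->
  cpow k x = cpow k y -> x = y.
Proof.
case: k => // k _; set t := _^-1 => cx cy.
have t0 : 0 < t by rewrite invr_gt0; have := ler0n R k.+1; lra.
(* The slope of a product of j factors is bounded by the linear 2 j t instead of tan(j arctan t).
   Passing to j + 1 amounts to (t (2 j + 2)) (2 t j) <= 1, and t is chosen so that both factors are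
   at most 1. *)
have mulcone j z w : (j <= k.+1)%N -> cone t z -> cone (2 * j%:R * t) w ->
    cone (2 * j.+1%:R * t) (cmul z w).
  move=> jk; have j0 := ler0n R j.
  have tj : t * (2 * j%:R + 2) <= 1.
    by rewrite mulrC ler_pdivrMr ?mul1r; [rewrite lerD2r ler_pM2l// ler_nat|
       have := ler0n R k.+1; lra].
  have tj0 : 0 <= t * j%:R by rewrite mulr_ge0// ltW.
  rewrite -natr1; apply: cone_mul; [lra|lra|lra|nra|].
  have : 0 <= t * (1 - (t * (2 * j%:R + 2)) * (2 * (t * j%:R))).
    by apply: mulr_ge0; [exact: ltW|rewrite subr_ge0 mulr_ile1; lra].
  by lra.
have [S [cS _ hS]] : exists S, [/\ cone (2 * k%:R * t) S,
    cone (2 * k.+1%:R * t) (cpow k.+1 y) &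
    cpow k.+1 x - cpow k.+1 y = cmul (x - y) S].
  have := leqnn k; elim: {-2}k => [|j ih] jk.
    exists (1, 0); split; first by split; rewrite /= ?normr0 ?mulr0 ?mul0r.
      rewrite /= cmulC cmul1; apply: cone_sub cy; lra.
    by rewrite [in RHS]cmulC cmul1 /= ![cmul _ (1, 0)]cmulC !cmul1.
  have [S [cS cyj hS]] := ih (ltnW jk).
  (* From x^(j+2) - y^(j+2) = x (x^(j+1) - y^(j+1)) + (x - y) y^(j+1). *)
  exists (cmul x S + cpow j.+1 y); split.
  - by apply: coneD => //; apply: mulcone => //; exact: leqW (ltnW _).
  - by rewrite cpowS; apply: mulcone => //; exact: leqW.
  - rewrite cmulDr cmulA [cmul _ x]cmulC -cmulA -hS !(cpowS j.+1).
    by rewrite /cmul; congr pair => /=; ring.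
move=> e; apply/eqP; rewrite -subr_eq0; apply/negPn/negP => xy.
have := cmul_neq0 xy (cone_neq0 cS).
by rewrite -hS e subrr eqxx.
Qed.

Lemma polar_angle z : dot z z = 1 -> exists theta, z = (cos theta, sin theta).
Proof.
case: z => u v; rewrite /dot /= -!expr2 => uv.
have u1 : -1 <= u <= 1.
  by rewrite -ler_norml -(ler_pXn2r (ltn0Sn 1)) ?nnegrE// expr1n real_normK ?num_real//;
    have := sqr_ge0 v; lra.
have cosu : cos (acos u) = u by apply: acosK; rewrite in_itv.
have sinv : sin (acos u) = `|v|.
  by rewrite sin_acos// -sqrtr_sqr; congr Num.sqrt; lra.
have [v0|v0] := leP 0 v.
  by exists (acos u); rewrite cosu sinv ger0_norm.
by exists (- acos u); rewrite cosN sinN cosu sinv ltr0_norm// opprK.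
Qed.

Lemma polar_form z : z != 0 ->
  exists rho theta, 0 < rho /\ z = rho *: (cos theta, sin theta).
Proof.
rewrite -dot_gt0 => z0; set r := Num.sqrt (dot z z).
have r0 : 0 < r by rewrite sqrtr_gt0.
have [|theta e] := @polar_angle (r^-1 *: z).
  have -> : dot (r^-1 *: z) (r^-1 *: z) = r^-1 ^+ 2 * dot z z.
    by rewrite /dot /= /GRing.scale /=; ring.
  by rewrite exprVn sqr_sqrtr ?ltW// mulVf// gt_eqF.
by exists r, theta; split=> //; rewrite -e scalerA divff ?scale1r// gt_eqF.
Qed.

End Complex.

(** * Ellipses *)

Section Ellipse.
Context {R : realType}.
Implicit Types (x y p r q s : R).

Definition ellipse x y p r q : R -> plane R :=
  fun s => (x + p * cos s, y + (r * cos s + q * sin s)).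

Lemma cos1_sin0 s : 1 <= cos s -> cos s = 1 /\ sin s = 0.
Proof.
move=> h; have c1 : cos s = 1 by have := cos_le1 s; lra.
by split=> //; apply: cos1sin0; rewrite c1 normr1.
Qed.

Lemma cosN1_sin0 s : cos s <= -1 -> cos s = -1 /\ sin s = 0.
Proof.
move=> h; have c1 : cos s = -1 by have := cos_geN1 s; lra.
by split=> //; apply: cos1sin0; rewrite c1 normrN normr1.
Qed.

(** The extreme abscissas x + p and x - p are reached only at s = 0 and s = pi, with ordinates y + r
    and y - r, which gives x, p, y and r. The top of the vertical chord through the center then
    gives q. *)
Lemma ellipse_range_inj x y p r q x' y' p' r' q' :
  0 < p -> 0 < q -> 0 < p' -> 0 < q' ->
  range (ellipse x y p r q) = range (ellipse x' y' p' r' q') ->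
  [/\ x = x', y = y', p = p', r = r' & q = q'].
Proof.
move=> p0 q0 p'0 q'0 e.
have H s : exists s', ellipse x y p r q s = ellipse x' y' p' r' q' s'.
  have : range (ellipse x y p r q) (ellipse x y p r q s) by exists s.
  by rewrite e => -[s' _ <-]; exists s'.
have H' s : exists s', ellipse x' y' p' r' q' s = ellipse x y p r q s'.
  have : range (ellipse x' y' p' r' q') (ellipse x' y' p' r' q' s) by exists s.
  by rewrite -e => -[s' _ <-]; exists s'.
have [s1 []] := H 0; have [s2 []] := H pi.
have [s1' []] := H' 0; have [s2' []] := H' pi.
have [s3 []] := H (pi / 2); have [s3' []] := H' (pi / 2).
rewrite cos_pihalf sin_pihalf cos0 sin0 cospi sinpi !mulr1 !mulr0 !addr0 !add0r.
move=> a3' b3' a3 b3 a2' b2' a1' b1' a2 b2 a1 b1.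
have pc t := ler_wpM2l (ltW p0) (cos_le1 t).
have pc' t := ler_wpM2l (ltW p'0) (cos_le1 t).
have pN t := ler_wpM2l (ltW p0) (cos_geN1 t).
have pN' t := ler_wpM2l (ltW p'0) (cos_geN1 t).
have xp : x + p = x' + p' by have := pc' s1; have := pc s1'; lra.
have xNp : x - p = x' - p' by have := pN' s2; have := pN s2'; lra.
have px : p' = p by lra.
have xx : x' = x by lra.
subst x' p'.
have [c1 d1] : cos s1 = 1 /\ sin s1 = 0.
  by apply: cos1_sin0; rewrite -(ler_pM2l p0); lra.
have [c2 d2] : cos s2 = -1 /\ sin s2 = 0.
  by apply: cosN1_sin0; rewrite -(ler_pM2l p0); lra.
rewrite c1 d1 in b1; rewrite c2 d2 in b2.
have ry : r' = r by lra.
have yy : y' = y by lra.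
subst r' y'.
have c3 : cos s3 = 0 by apply: (mulfI (lt0r_neq0 p0)); lra.
have c3' : cos s3' = 0 by apply: (mulfI (lt0r_neq0 p0)); lra.
rewrite c3 in b3; rewrite c3' in b3'.
have := ler_wpM2l (ltW q0) (sin_le1 s3').
have := ler_wpM2l (ltW q'0) (sin_le1 s3).
by split=> //; lra.
Qed.

(** Composing the symmetry about c with the one about (x, y), which is s |-> s + pi, yields a
    translation of the ellipse into itself. The extreme abscissas forbid a horizontal part, and
    uniqueness of the rightmost point a vertical one. *)
Lemma ellipse_center_uniq x y p r q (c : plane R) : 0 < p ->
  (forall s, exists s',
     2 *: c - ellipse x y p r q s = ellipse x y p r q s') ->
  c = (x, y).
Proof.
case: c => c d p0 H.
have T s : exists s',
    ellipse x y p r q s + 2 *: ((c, d) - (x, y)) = ellipse x y p r q s'.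
  have [s' e] := H (s + pi); exists s'; rewrite -e.
  by rewrite /ellipse cosDpi sinDpi; congr pair; rewrite /= /GRing.scale /=; ring.
have pc t := ler_wpM2l (ltW p0) (cos_le1 t).
have pN t := ler_wpM2l (ltW p0) (cos_geN1 t).
have [s1 []] := T 0; have [s2 []] := T pi.
rewrite cos0 sin0 cospi sinpi /GRing.scale /= => a2 _ a1 b1.
have cx : c = x by have := pc s1; have := pN s2; lra.
subst c.
have [c1 d1] : cos s1 = 1 /\ sin s1 = 0.
  by apply: cos1_sin0; rewrite -(ler_pM2l p0); lra.
by rewrite c1 d1 in b1; congr pair; lra.
Qed.

(* The triangular parametrisation is an LQ decomposition: the orthogonal factor
   is a rotation, absorbed by the shift [phi] of the parameter. *)
Lemma ellipse_normal_form (a b c d : R) : 0 < a * d - b * c ->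
  exists p r q phi, [/\ 0 < p, 0 < q,
    p ^+ 2 + r ^+ 2 + q ^+ 2 = a ^+ 2 + b ^+ 2 + c ^+ 2 + d ^+ 2 &
    forall s, a * cos s + b * sin s = p * cos (s - phi) /\
              c * cos s + d * sin s = r * cos (s - phi) + q * sin (s - phi)].
Proof.
move=> D; set n := Num.sqrt (a ^+ 2 + b ^+ 2).
have ab0 : 0 < a ^+ 2 + b ^+ 2.
  rewrite lt_neqAle addr_ge0 ?sqr_ge0// andbT eq_sym paddr_eq0 ?sqr_ge0//.
  by rewrite !sqrf_eq0; apply/negP => /andP[/eqP a0 /eqP b0]; move: D; rewrite a0 b0; lra.
have n0 : 0 < n by rewrite sqrtr_gt0.
have nn : n != 0 by exact: lt0r_neq0.
have n2 : n ^+ 2 = a ^+ 2 + b ^+ 2 by rewrite sqr_sqrtr// ltW.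
have [|phi [e1 e2]] := @polar_angle R (a / n, b / n).
  by rewrite /dot /=; field: n2; lra.
exists n, ((a * c + b * d) / n), ((a * d - b * c) / n), phi; split=> //.
- exact: divr_gt0.
- apply: (mulfI (expf_neq0 2 nn)).
  have -> : n ^+ 2 * (n ^+ 2 + ((a * c + b * d) / n) ^+ 2 + ((a * d - b * c) / n) ^+ 2)
     = n ^+ 2 * n ^+ 2 + (a * c + b * d) ^+ 2 + (a * d - b * c) ^+ 2 by field.
  by rewrite n2; ring.
- move=> s; rewrite cosB sinB -e1 -e2; split; apply: (mulfI (expf_neq0 2 nn)).
    have -> : n ^+ 2 * (n * (cos s * (a / n) + sin s * (b / n))) =
      n ^+ 2 * (a * cos s + b * sin s) by field.
    by [].
  set l := RHS; have -> : l = (a ^+ 2 + b ^+ 2) * (c * cos s + d * sin s).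
    by rewrite /l; field.
  by rewrite n2.
Qed.

End Ellipse.

(** * The force function in the coordinate z *)

Section ElementaryPlane.
Context {R : realType} {V : normedModType R}.
Implicit Types f g : V -> plane R.

Definition elementary2 f :=
  elementary (fun v => (f v).1) /\ elementary (fun v => (f v).2).

Lemma elementary2_smooth (O : set V) f : elementary2 f -> smooth O f.
Proof.
case=> e1 e2; rewrite (_ : f = fun v => ((f v).1, (f v).2)).
  exact: elementary_smooth_pair.
by apply/funext => v; exact: surjective_pairing.
Qed.

Lemma elementary2_cmul f g : elementary2 f -> elementary2 g ->
  elementary2 (fun v => cmul (f v) (g v)).
Proof.
move=> [f1 f2] [g1 g2]; split=> /=.
  by apply: elementaryB; exact: elementaryM.
by apply: elementaryD; exact: elementaryM.
Qed.

Lemma elementary2_cpow n f : elementary2 f -> elementary2 (fun v => cpow n (f v)).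
Proof.
move=> ef; elim: n => [|n ih]; first by split; exact: elementary_cst.
exact: elementary2_cmul.
Qed.

Lemma elementary_cross f g : elementary2 f -> elementary2 g ->
  elementary (fun v => cross (f v) (g v)).
Proof. by move=> [f1 f2] [g1 g2]; apply: elementaryB; exact: elementaryM. Qed.

Lemma elementary2_ellipse (x y p r q s : V -> R) :
  elementary x -> elementary y -> elementary p -> elementary r ->
  elementary q -> elementary s ->
  elementary2 (fun v => ellipse (x v) (y v) (p v) (r v) (q v) (s v)).
Proof.
move=> ex ey ep er eq es; have ec := elementary_cos es.
have esi := elementary_sin es; split=> /=.
  by apply: elementaryD => //; exact: elementaryM.
by apply: elementaryD => //; apply: elementaryD; exact: elementaryM.
Qed.

End ElementaryPlane.

Section Billiard.
Context {R : realType}.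

Lemma elementary2_fst : elementary2 (fun X : plane R * plane R => X.1).
Proof.
split; apply: elementary_linear => X.
  exact: (is_diff_comp (is_diff_fst X) (is_diff_fst _)).
exact: (is_diff_comp (is_diff_fst X) (is_diff_snd _)).
Qed.

Lemma elementary2_snd : elementary2 (fun X : plane R * plane R => X.2).
Proof.
split; apply: elementary_linear => X.
  exact: (is_diff_comp (is_diff_snd X) (is_diff_fst _)).
exact: (is_diff_comp (is_diff_snd X) (is_diff_snd _)).
Qed.

Implicit Types (n m : nat) (x y p r q s t : R) (z w : plane R)
  (X : plane R * plane R).

Lemma is_derive_cpow n (z : R -> plane R) t (dz : plane R) :
  is_derive t 1 z dz ->
  is_derive t 1 (fun u => cpow n.+1 (z u)) (n.+1%:R *: cmul (cpow n (z t)) dz).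
Proof.
move=> hz; elim: n => [|n ih].
  rewrite (_ : (fun u => _) = z).
    by rewrite scale1r cmul1.
  by apply/funext => u; rewrite cpowS cmulC cmul1.
have [z1 z2] := (is_derive1_pairP _ _ _).1 hz.
have [c1 c2] := (is_derive1_pairP _ _ _).1 ih.
apply/is_derive1_pairP; split.
- apply: (is_derive_eq (is_deriveB (is_deriveM z1 c1) (is_deriveM z2 c2))).
  by rewrite -[in RHS]natr1 cpowS /= /GRing.scale /=; ring.
- apply: (is_derive_eq (is_deriveD (is_deriveM z1 c2) (is_deriveM z2 c1))).
  by rewrite -[in RHS]natr1 cpowS /= /GRing.scale /=; ring.
Qed.

Lemma force_functionE m z : (0 < m)%N ->
  force_function m.+1 z = dot z z `^ (- (m%:R / m.+1%:R)).
Proof.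
move=> m0; have m1 : (m.+1%:R : R) != 0 by rewrite pnatr_eq0.
rewrite /force_function /enorm -powR12_sqrt ?dot_ge0// -powRrM div1r -powRN.
have -> : m%:R = m.+1%:R - 1 :> R by rewrite -natr1 addrK.
by congr powR; field.
Qed.

(** This is where the exponent 2 - 2/k comes from: |dq/dz|^2 = k^2 |z|^(2m) with m = k - 1, so
    U(z^k) |dq/dz|^2 is the constant k^2, and the Maupertuis metric at energy 0 is flat in the
    z-plane. *)
Lemma force_function_cpow m z : (0 < m)%N ->
  force_function m.+1 (cpow m.+1 z) = dot z z ^- m.
Proof.
move=> m0; have m1 : (m.+1%:R : R) != 0 by rewrite pnatr_eq0.
rewrite force_functionE// dot_cpow -powR_mulrn ?dot_ge0// -powRrM.
have -> : m.+1%:R * - (m%:R / m.+1%:R) = - m%:R :> R by field.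
by rewrite powRN powR_mulrn// dot_ge0.
Qed.

Lemma gradient_force_function m z : (0 < m)%N -> z != 0 ->
  gradient (force_function m.+1) (cpow m.+1 z) =
  (- 2 * m%:R / m.+1%:R * dot z z ^- (2 * m).+1) *: cpow m.+1 z.
Proof.
move=> m0 z0; have m1 : (m.+1%:R : R) != 0 by rewrite pnatr_eq0.
set q := cpow m.+1 z; have q0 : q != 0 by exact: cpow_neq0.
set e := - (m%:R / m.+1%:R) : R.
have -> : @force_function R m.+1 = (fun u : R => u `^ e) \o (fun v : plane R => dot v v).
  by apply/funext => v; rewrite force_functionE.
have dd : is_diff q (fun v : plane R => dot v v)
    (fun v => (q.1 * v.1 + q.1 * v.1) + (q.2 * v.2 + q.2 * v.2)).
  by apply: is_diffD; apply: is_diffM; (exact: is_diff_fst || exact: is_diff_snd).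
have g0 : 0 < dot q q by rewrite dot_gt0.
have dp : is_diff (dot q q) (fun u : R => u `^ e) ( *:%R^~ (e * dot q q `^ (e - 1))).
  exact/is_derive1_is_diff/is_derive1_powR.
have dU v := is_derive_diff v (is_diff_comp dd dp).
have E : dot q q `^ (e - 1) = dot z z ^- (2 * m).+1.
  rewrite dot_cpow -powR_mulrn ?dot_ge0// -powRrM.
  have -> : m.+1%:R * (e - 1) = - (2 * m).+1%:R :> R.
    rewrite -(natr1 (2 * m)) natrM /e.
    by have -> : m%:R = m.+1%:R - 1 :> R; [rewrite -natr1 addrK|field].
  by rewrite powRN powR_mulrn// dot_ge0.
rewrite /gradient !(@derive_val _ _ _ _ _ _ _ (dU _)) /= E /e.
by congr pair; rewrite /GRing.scale /=; ring.
Qed.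

Lemma lifted_energyE m X : (0 < m)%N ->
  lifted_energy (force_function m.+1) m.+1 X = dot X.2 X.2 / 2 - dot X.1 X.1 ^- m.
Proof. by move=> m0; rewrite /lifted_energy /energy force_function_cpow. Qed.

End Billiard.

(** * Joachimsthal's integral *)

Section FirstIntegral.
Context {R : realType}.
Implicit Types (n m : nat) (x y p r q s t : R) (z w : plane R)
  (X : plane R * plane R).

(* In the coordinate z, where dq = k z^(k-1) dz, the zero-energy motions are
   straight lines up to a change of time; [free_momentum] is the momentum of
   this free motion (m = k - 1). *)
Definition free_momentum m X : plane R := cmul X.2 (cconj (cpow m X.1)).

(* Joachimsthal's integral, for the ellipse with center (x, y) and conjugate
   semi-axes (p, r) and (0, q); on the ellipse it is -(tangent x momentum)^2. *)
Definition joachimsthal m x y p r q X : R :=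
  cross (X.1 - (x, y)) (free_momentum m X) ^+ 2
  - (cross (p, r) (free_momentum m X) ^+ 2
     + cross (0, q) (free_momentum m X) ^+ 2).

Lemma is_derive0_cst_itv (a b : R) (f : R -> R) :
  (forall t, t \in `]a, b[ -> is_derive t 1 f 0) ->
  forall s t, s \in `]a, b[ -> t \in `]a, b[ -> f s = f t.
Proof.
move=> h s t; wlog st : s t / s <= t => [W sI tI|].
  by case: (leP s t) => [|/ltW] st; [|symmetry]; exact: W.
rewrite !in_itv/= => /andP[a_s _] /andP[_ tb].
have sub u : u \in `[s, t] -> is_derive u 1 f 0.
  rewrite in_itv/= => /andP[su ut]; apply: h.
  by rewrite in_itv/= (lt_le_trans a_s su) (le_lt_trans ut tb).
have doo u : u \in `]s, t[ -> is_derive u 1 f ((fun=> 0) u).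
  by move=> uI; apply: sub; exact: subset_itv_oo_cc.
have cf : {within `[s, t], continuous f}.
  by apply: derivable_within_continuous => u /sub hu; exact: ex_derive.
have [c _] := MVT_segment st doo cf.
by rewrite mul0r => /subr0_eq.
Qed.

(** Since p = k z^m z', multiplying by the conjugate of z^m gives k |z|^(2m) z'. In the derivative
    of this product, the force term and the term from z^m are both real multiples of z, and they
    cancel because the energy is 0. *)
Lemma free_momentum_velocity m (a b : R) (z p : R -> plane R) t :
  (0 < m)%N -> lifted_motion (force_function m.+1) 0 m.+1 a b z p ->
  t \in `]a, b[ ->
  exists dz : plane R, [/\ is_derive t 1 z dz,
    free_momentum m (z t, p t) = (m.+1%:R * dot (z t) (z t) ^+ m) *: dz &
    is_derive t 1 (fun u => free_momentum m (z u, p u)) 0].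
Proof.
move=> m0 [dz onE mot] tI.
have [n mE] : exists n, m = n.+1 by exists m.-1; rewrite prednK.
have [v {}dz] : exists v : plane R, is_derive t 1 z v.
  by exists ('D_1 z t); exact/derivableP/dz.
exists v.
have [/= z0 e0] := onE t tI.
have [dq dp] := mot t tI.
have pE : m.+1%:R *: cmul (cpow m (z t)) v = p t.
  rewrite -(@derive_val _ _ _ _ _ _ _ dq).
  by rewrite -(@derive_val _ _ _ _ _ _ _ (is_derive_cpow m dz)).
have N0 : dot (z t) (z t) != 0 by rewrite dot_eq0.
have m1 : (m.+1%:R : R) != 0 by rewrite pnatr_eq0.
split=> //.
  have := dot_cpow m (z t); rewrite /free_momentum /= -pE.
  move: (cpow m (z t)) => Z.
  by rewrite /dot /cconj /cmul /= /GRing.scale /= => <-; congr pair; rewrite /GRing.scale /=; ring.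
have ZE : cpow m (z t) = cmul (z t) (cpow n (z t)) by rewrite mE.
have Nn : dot (z t) (z t) ^+ m = dot (z t) (z t) ^+ n * dot (z t) (z t).
  by rewrite mE exprSr.
have dZ : is_derive t 1 (fun u => cpow m (z u)) (m%:R *: cmul (cpow n (z t)) v).
  by rewrite mE; exact: is_derive_cpow.
have [p1 p2] := (is_derive1_pairP _ _ _).1 dp.
have [Z1 Z2] := (is_derive1_pairP _ _ _).1 dZ.
have W0 : cmul (gradient (force_function m.+1) (cpow m.+1 (z t)))
            (cconj (cpow m (z t)))
        + cmul (p t) (cconj (m%:R *: cmul (cpow n (z t)) v)) = 0.
  (* Zero energy determines the speed in the z-plane: |v|^2 = 2 / (k^2 |z|^(4m)). *)
  have v2 : dot v v = 2 / (m.+1%:R ^+ 2 * (dot (z t) (z t) ^+ m) ^+ 2).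
    move: e0; rewrite lifted_energyE//= -pE => /subr0_eq.
    have -> : dot (m.+1%:R *: cmul (cpow m (z t)) v) (m.+1%:R *: cmul (cpow m (z t)) v)
        = m.+1%:R ^+ 2 * (dot (z t) (z t) ^+ m) * dot v v.
      by rewrite -dot_cpow -mulrA -dot_cmul /dot /= /GRing.scale /=; ring.
    have h (c d u : R) : c != 0 -> d != 0 ->
        c ^+ 2 * d * u / 2 = d^-1 -> u = 2 / (c ^+ 2 * d ^+ 2).
      move=> c0 d0 e; apply: (mulfI (_ : c ^+ 2 * d / 2 != 0)).
        by rewrite !mulf_neq0 ?expf_neq0 ?invr_eq0 ?pnatr_eq0.
      by rewrite mulrAC e; field; rewrite c0 d0.
    by apply: h => //; exact: expf_neq0.
  have -> : cmul (p t) (cconj (m%:R *: cmul (cpow n (z t)) v)) =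
      (m%:R * m.+1%:R * dot (z t) (z t) ^+ n * dot v v) *: z t.
    rewrite -pE -dot_cpow ZE; move: (cpow n (z t)) => Y.
    rewrite /dot /cconj /cmul /= /GRing.scale /=.
    by congr pair; rewrite /GRing.scale /=; ring.
  rewrite gradient_force_function//.
  have -> c : cmul (c *: cpow m.+1 (z t)) (cconj (cpow m (z t))) =
      (c * dot (z t) (z t) ^+ m) *: z t.
    rewrite -dot_cpow cpowS; move: (cpow m (z t)) => Z.
    rewrite /dot /cconj /cmul /= /GRing.scale /=.
    by congr pair; rewrite /GRing.scale /=; ring.
  rewrite -scalerDl v2 [X in X *: _](_ : _ = 0) ?scale0r//.
  rewrite exprS mul2n -addnn exprD Nn.
  have Nn0 : dot (z t) (z t) ^+ n != 0 by rewrite expf_neq0.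
  move: (m.+1%:R : R) (dot _ _ ^+ n) m1 Nn0 => c d c0 d0.
  by field; rewrite c0 N0 d0.
move: (gradient _ _) (_ *: _) W0 p1 p2 Z1 Z2 {dp dZ} => G D W0 p1 p2 Z1 Z2.
apply/is_derive1_pairP; split.
- apply: (is_derive_eq (is_deriveB (is_deriveM p1 Z1) (is_deriveM p2 (is_deriveN Z2)))).
  rewrite -W0 !fctE /=; move: (p t) (cpow m (z t)) => P Z.
  by rewrite /GRing.scale /=; ring.
- apply: (is_derive_eq (is_deriveD (is_deriveM p1 (is_deriveN Z2)) (is_deriveM p2 Z1))).
  rewrite -W0 !fctE /=; move: (p t) (cpow m (z t)) => P Z.
  by rewrite /GRing.scale /=; ring.
Qed.

(** The free momentum is constant and parallel to z', so each of the three cross products has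
    derivative 0. *)
Lemma joachimsthal_motion m x y p r q : (0 < m)%N ->
  preserved_by_motion (force_function m.+1) 0 m.+1 (joachimsthal m x y p r q).
Proof.
move=> m0 a b z P mot; apply: (@is_derive0_cst_itv _ _ (fun u =>
  joachimsthal m x y p r q (z u, P u))) => t tI.
have [v [dz wE dw]] := free_momentum_velocity m0 mot tI.
have [z1 z2] := (is_derive1_pairP _ _ _).1 dz.
have [w1 w2] := (is_derive1_pairP _ _ _).1 dw.
have dcross (c : R -> plane R) dc : is_derive t 1 c dc ->
    cross dc (free_momentum m (z t, P t)) = 0 ->
    is_derive t 1 (fun u => cross (c u) (free_momentum m (z u, P u)) ^+ 2) 0.
  move=> /is_derive1_pairP[c1 c2] e.
  have h : is_derive t 1 (fun u => cross (c u) (free_momentum m (z u, P u))) 0.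
    apply: (is_derive_eq (is_deriveB (is_deriveM c1 w2) (is_deriveM c2 w1))).
    by rewrite -e /cross /= /GRing.scale /=; ring.
  by apply: (is_derive_eq (is_deriveM h h)); rewrite !scaler0 addr0.
have h1 := dcross (fun u => z u - (x, y)) _ (is_deriveB dz (is_derive_cst _ _ _)).
have h2 c := dcross (fun=> c) _ (is_derive_cst _ _ _).
apply: (is_derive_eq (is_deriveB (h1 _) (is_deriveD (h2 (p, r) _) (h2 (0, q) _)))).
- by rewrite subr0 wE /cross /= /GRing.scale /=; ring.
- by rewrite /cross /= !mul0r subrr.
- by rewrite /cross /= !mul0r subrr.
- by rewrite addr0 subr0.
Qed.

Lemma joachimsthal_elementary m x y p r q : elementary (joachimsthal m x y p r q).
Proof.
have ez := @elementary2_fst R; have ep := @elementary2_snd R.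
have ew : elementary2 (fun X : plane R * plane R => free_momentum m X).
  apply: elementary2_cmul => //; have [e1 e2] := elementary2_cpow m ez.
  by split=> //=; exact: elementaryN.
have ecst (c : plane R) : elementary2 (fun X : plane R * plane R => c).
  by split; exact: elementary_cst.
have esq (c : plane R * plane R -> plane R) : elementary2 c ->
    elementary (fun X => cross (c X) (free_momentum m X) ^+ 2).
  by move=> ec; apply: elementaryM; exact: elementary_cross.
apply: elementaryB; last by apply: elementaryD; exact: esq.
apply: esq; case: ez => e1 e2.
by split; apply: elementaryB => //; exact: elementary_cst.
Qed.

(** Multiplication by the conjugate of z^m is a similarity, hence commutes with reflections, and it
    takes the wall tangent k z^m v to a real multiple of v. *)
Lemma free_momentum_reflect m z v P : z != 0 -> v != 0 ->
  free_momentum m (z, reflect_along (m.+1%:R *: cmul (cpow m z) v) P) =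
  reflect_along v (free_momentum m (z, P)).
Proof.
move=> z0 v0; have m1 : (m.+1%:R : R) != 0 by rewrite pnatr_eq0.
have := cpow_neq0 m z0; rewrite /free_momentum /=; move: (cpow m z) => Z.
move: (m.+1%:R : R) m1 => c c0.
case: Z P v v0 => [Z1 Z2] [P1 P2] [v1 v2]; rewrite -!dot_eq0.
rewrite /reflect_along /cmul /dot /cconj /= /GRing.scale /= => v0 Z0.
have h : c * (Z1 * v1 - Z2 * v2) * (c * (Z1 * v1 - Z2 * v2)) +
    c * (Z1 * v2 + Z2 * v1) * (c * (Z1 * v2 + Z2 * v1)) =
    c ^+ 2 * (Z1 * Z1 + Z2 * Z2) * (v1 * v1 + v2 * v2) by ring.
by congr pair; rewrite /GRing.scale /= h /GRing.scale /=; field; rewrite c0 Z0 v0.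
Qed.

Lemma is_derive_ellipse x y p r q s : is_derive s 1 (ellipse x y p r q)
  (- (p * sin s), q * cos s - r * sin s).
Proof.
apply/is_derive1_pairP; split.
  apply: (is_derive_eq (is_deriveD (is_derive_cst x s 1)
    (is_deriveM (is_derive_cst p s 1) (is_derive_cos s)))).
  by rewrite /= /GRing.scale /=; ring.
apply: (is_derive_eq (is_deriveD (is_derive_cst y s 1)
  (is_deriveD (is_deriveM (is_derive_cst r s 1) (is_derive_cos s))
     (is_deriveM (is_derive_cst q s 1) (is_derive_sin s))))).
by rewrite /= /GRing.scale /=; ring.
Qed.

Lemma ellipse_velocity_neq0 p r q s : 0 < p -> 0 < q ->
  (- (p * sin s), q * cos s - r * sin s) != 0 :> plane R.
Proof.
move=> p0 q0; apply/eqP => -[/eqP]; rewrite oppr_eq0 mulf_eq0 gt_eqF//=.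
move=> /eqP s0; rewrite s0 mulr0 subr0 => /eqP.
rewrite mulf_eq0 gt_eqF//= => /eqP c0.
by have := cos2Dsin2 s; rewrite s0 c0 expr0n addr0 => /eqP; rewrite eq_sym oner_eq0.
Qed.

(** With A = (p, r) and B = (0, q), the radius is cos s A + sin s B and the tangent -sin s A + cos s
    B. Their cross products with w are thus the pair (A x w, B x w) rotated, with the same sum of
    squares. *)
Lemma joachimsthal_on_ellipse m x y p r q s P :
  joachimsthal m x y p r q (ellipse x y p r q s, P) =
  - cross (- (p * sin s), q * cos s - r * sin s)
          (free_momentum m (ellipse x y p r q s, P)) ^+ 2.
Proof.
rewrite /joachimsthal; move: (free_momentum _ _) => [u v]; rewrite /cross /=.
have cs := cos2Dsin2 s; apply/eqP; rewrite -subr_eq0; apply/eqP.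
transitivity ((cos s ^+ 2 + sin s ^+ 2 - 1) *
  ((p * v - r * u) ^+ 2 + (0 * v - q * u) ^+ 2)); first by ring.
by rewrite cs subrr mul0r.
Qed.

End FirstIntegral.

(** * Reflections, and differentials along momentum directions *)

Section Independence.
Context {R : realType}.
Implicit Types (n m : nat) (x y p r q s t : R) (z w : plane R)
  (X : plane R * plane R).

Lemma joachimsthal_reflections m x y p r q : 0 < p -> 0 < q ->
  (forall s, ellipse x y p r q s != 0) ->
  preserved_by_reflections (force_function m.+1) 0 m.+1 (ellipse x y p r q)
    (joachimsthal m x y p r q).
Proof.
move=> p0 q0 g0 s P _; have v0 := ellipse_velocity_neq0 r s p0 q0.
have -> := @derive_val _ _ _ _ _ _ _
  (is_derive_cpow m (is_derive_ellipse x y p r q s)).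
rewrite !joachimsthal_on_ellipse free_momentum_reflect//.
move: (free_momentum _ _) v0 => w; move: (_, _) => v _.
(* Reflection along v only changes the sign of v x w, which the square forgets. *)
congr (- _); rewrite -[in RHS]sqrrN; congr (_ ^+ 2).
by rewrite /cross /reflect_along /= /GRing.scale /=; ring.
Qed.

(** Reduces a value of the differential to one real variable: along a line in the momentum, the
    energy and the integral are quadratic polynomials in h, whose linear coefficient is read off. *)
Lemma diff_along (V : normedModType R) (f : V -> R) (a v : V) (d : R) :
  differentiable f a -> is_derive (0 : R) 1 (fun h : R => f (a + h *: v)) d ->
  'd f a v = d.
Proof.
move=> fa fd.
have c : is_derive (0 : R) 1 (fun h : R => a + h *: v) v.
  have : is_diff (0 : R) (fun h : R => a + h *: v) (fun h => 0 + h *: v).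
    by apply: is_diffD.
  by move=> /(is_derive_diff (1 : R)); rewrite add0r scale1r.
have h : is_diff (a + 0 *: v) f ('d f a).
  by rewrite scale0r addr0; exact: DiffDef.
by rewrite -(@derive_val _ _ _ _ _ _ _ (is_derive1_comp_diff c h))
  (@derive_val _ _ _ _ _ _ _ fd).
Qed.

Lemma is_derive0_quadratic (a b c : R) :
  is_derive (0 : R) 1 (fun h : R => a + (h * b + h * h * c)) b.
Proof.
have i := is_derive_id (0 : R) (1 : R).
apply: (is_derive_eq (is_deriveD (is_derive_cst a _ _)
  (is_deriveD (is_deriveM i (is_derive_cst b _ _))
     (is_deriveM (is_deriveM i i) (is_derive_cst c _ _))))).
by rewrite /cst /= !scale0r !scaler0 !add0r scaler0 addr0; exact: mulr1.
Qed.

Lemma lifted_energy_diff m X (u : plane R) : (0 < m)%N -> X.1 != 0 ->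
  'd (lifted_energy (force_function m.+1) m.+1) X (0, u) = dot X.2 u.
Proof.
move=> m0 z0.
have E : lifted_energy (@force_function R m.+1) m.+1 =
    (fun Y : plane R * plane R => dot Y.2 Y.2 * 2^-1 - (dot Y.1 Y.1 ^+ m)^-1).
  by apply/funext => Y; rewrite lifted_energyE.
have [e11 e12] := @elementary2_fst R; have [e21 e22] := @elementary2_snd R.
apply: diff_along.
  rewrite E; apply: differentiableB.
    apply: elementary_differentiable; apply: elementaryM; last exact: elementary_cst.
    by apply: elementaryD; exact: elementaryM.
  apply: differentiableV; last by rewrite expf_neq0// dot_eq0.
  apply: elementary_differentiable; apply: elementaryX.
  by apply: elementaryD; exact: elementaryM.
rewrite E (_ : (fun h => _) = (fun h => (dot X.2 X.2 / 2 - (dot X.1 X.1 ^+ m)^-1)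
   + (h * dot X.2 u + h * h * (dot u u / 2)))); last first.
  apply/funext => h /=; rewrite (_ : X.1 + h *: 0 = X.1) ?scaler0 ?addr0//.
  move: (dot X.1 X.1 ^+ m)^-1 => c; rewrite /dot /= /GRing.scale /=.
  by field.
exact: is_derive0_quadratic.
Qed.

Lemma joachimsthal_diff m x y p r q X (u : plane R) :
  let w := free_momentum m X in
  let dw := cmul u (cconj (cpow m X.1)) in
  'd (joachimsthal m x y p r q) X (0, u) =
  2 * (cross (X.1 - (x, y)) w * cross (X.1 - (x, y)) dw
       - (cross (p, r) w * cross (p, r) dw + cross (0, q) w * cross (0, q) dw)).
Proof.
move=> w dw; apply: diff_along.
  exact/elementary_differentiable/joachimsthal_elementary.
rewrite (_ : (fun h => _) = (fun h => joachimsthal m x y p r q X +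
    (h * (2 * (cross (X.1 - (x, y)) w * cross (X.1 - (x, y)) dw
       - (cross (p, r) w * cross (p, r) dw + cross (0, q) w * cross (0, q) dw)))
     + h * h * (cross (X.1 - (x, y)) dw ^+ 2
                - (cross (p, r) dw ^+ 2 + cross (0, q) dw ^+ 2))))); last first.
  apply/funext => h; rewrite /joachimsthal.
  have -> : free_momentum m (X + h *: (0, u)) = w + h *: dw.
    rewrite /w /dw /free_momentum /= scaler0 addr0.
    move: (cpow m X.1) (X.2) => Z P; case: Z P => [? ?] [? ?]; case: (u) => ? ?.
    by rewrite /cmul /= /GRing.scale /=; congr pair; rewrite /= /GRing.scale /=; ring.
  rewrite -/w /= scaler0 addr0; move: w dw (X.1 - _) => w dw d.
  by rewrite /cross /= /GRing.scale /=; ring.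
exact: is_derive0_quadratic.
Qed.

End Independence.

(** * Independence from the energy on a dense subset *)

Section Density.
Context {R : realType}.
Implicit Types (n m : nat) (x y p r q s t : R) (z w : plane R)
  (X : plane R * plane R).

(* Turns the momentum and moves the position radially; the factor (1+u)^(-m)
   keeps the energy equal to 0 and the norm of the free momentum fixed. *)
Definition flow_turn m X (u : plane R) : plane R * plane R :=
  ((1 + u.1) *: X.1,
   ((1 + u.1) ^+ m)^-1 *: cmul (cos u.2, sin u.2) X.2).

Lemma flow_turn_cvg m X : flow_turn m X u @[u --> (0, 0)] --> X.
Proof.
have e1 : elementary (fun u : plane R => 1 + u.1).
  apply: elementaryD; first exact: elementary_cst.
  by apply: elementary_linear => u; exact: is_diff_fst.
have e2 : elementary (fun u : plane R => u.2).
  by apply: elementary_linear => u; exact: is_diff_snd.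
have ec := elementary_cos e2; have es := elementary_sin e2.
have ecst (c : R) : elementary (fun u : plane R => c) by exact: elementary_cst.
have : differentiable (flow_turn m X) (0, 0).
  apply: differentiable_pair; apply: differentiable_pair => /=.
  - by apply: elementary_differentiable; exact: elementaryM.
  - by apply: elementary_differentiable; exact: elementaryM.
  - apply: differentiableM.
      apply: differentiableV; first exact/elementary_differentiable/elementaryX.
      by rewrite addr0 expr1n oner_eq0.
    by apply: elementary_differentiable; apply: elementaryB; exact: elementaryM.
  - apply: differentiableM.
      apply: differentiableV; first exact/elementary_differentiable/elementaryX.
      by rewrite addr0 expr1n oner_eq0.
    by apply: elementary_differentiable; apply: elementaryD; exact: elementaryM.
have E : flow_turn m X (0, 0) = X.
  rewrite /flow_turn /= addr0 expr1n invr1 !scale1r cos0 sin0 cmul1.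
  by rewrite -surjective_pairing.
by move=> /differentiable_continuous h; rewrite -{2}E; exact: h.
Qed.

Lemma cpowZ n (c : R) z : cpow n (c *: z) = c ^+ n *: cpow n z.
Proof.
elim: n => [|n ih]; first by rewrite expr0 scale1r.
rewrite !cpowS ih exprS; move: (cpow n z) => Z.
by rewrite /cmul /= /GRing.scale /=; congr pair; rewrite /= /GRing.scale /=; ring.
Qed.

Lemma flow_turn_surface m X (u : plane R) : (0 < m)%N -> 0 < 1 + u.1 ->
  energy_surface (force_function m.+1) 0 m.+1 X ->
  energy_surface (force_function m.+1) 0 m.+1 (flow_turn m X u).
Proof.
move=> m0; rewrite /flow_turn; move: (1 + u.1) (u.2) => c a c0 [/= z0 e0].
have cm0 : c ^+ m != 0 by rewrite expf_neq0// gt_eqF.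
split; first by rewrite /lifted_phase_space /= scaler_eq0 negb_or gt_eqF.
rewrite /= lifted_energyE//=; rewrite lifted_energyE//= in e0.
have dZ (b : R) (v : plane R) : dot (b *: v) (b *: v) = b ^+ 2 * dot v v.
  by rewrite /dot /= /GRing.scale /=; ring.
have -> : dot (c *: X.1) (c *: X.1) ^- m = (c ^+ m)^-1 ^+ 2 * dot X.1 X.1 ^- m.
  by rewrite dZ exprMn invfM -exprM mulnC exprM exprVn.
have rot : dot (cos a, sin a) (cos a, sin a) = 1.
  by rewrite /dot /= -!expr2 cos2Dsin2.
rewrite dZ dot_cmul rot mul1r.
by rewrite -mulrA -mulrBr e0 mulr0.
Qed.

Lemma flow_turn_momentum m X (u : plane R) : 0 < 1 + u.1 ->
  free_momentum m (flow_turn m X u) =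
  cmul (cos u.2, sin u.2) (free_momentum m X).
Proof.
rewrite /flow_turn /free_momentum /=; move: (1 + u.1) => c c0.
have cm0 : c ^+ m != 0 by rewrite expf_neq0// gt_eqF.
rewrite cpowZ; move: (c ^+ m) (cpow m X.1) X.2 cm0 => d [? ?] [? ?] d0.
by rewrite /cmul /cconj /= /GRing.scale /=; congr pair; rewrite /= /GRing.scale /=; field.
Qed.

(* The cross product is the derivative of the integral when the momentum is
   rotated, a direction along which the energy is constant. *)
Lemma joachimsthal_independent m x y p r q X : (0 < m)%N ->
  energy_surface (force_function m.+1) 0 m.+1 X ->
  cross (cmul (X.1 - (x, y)) (X.1 - (x, y))
         - (cmul (p, r) (p, r) + cmul (0, q) (0, q)))
    (cmul (free_momentum m X) (free_momentum m X)) != 0 ->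
  independent_at (lifted_energy (force_function m.+1) m.+1)
    (joachimsthal m x y p r q) X.
Proof.
move=> m0 [/= z0 e0] G0 a b H.
(* At energy 0 the kinetic energy equals U > 0, so the momentum cannot vanish. *)
have P0 : dot X.2 X.2 != 0.
  apply/eqP => P0; move/eqP: e0; rewrite lifted_energyE// P0 mul0r sub0r oppr_eq0.
  by rewrite invr_eq0 expf_eq0 dot_eq0 (negPf z0) andbF.
have b0 : b = 0.
  have := H (0, (- X.2.2, X.2.1)).
  rewrite lifted_energy_diff// joachimsthal_diff.
  have -> : dot X.2 (- X.2.2, X.2.1) = 0 by rewrite /dot /=; ring.
  rewrite mulr0 add0r => /eqP; rewrite mulf_eq0 => /orP[/eqP//|].
  have -> : cmul (- X.2.2, X.2.1) (cconj (cpow m X.1)) =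
    (- (free_momentum m X).2, (free_momentum m X).1).
    by rewrite /free_momentum /cmul /=; congr pair; ring.
  (* The complex squares arise from 2 (d x w) (d x iw) = d^2 x w^2, applied to the three terms of
     the integral. *)
  move=> /eqP E; move/eqP: G0; case; rewrite -[RHS]E.
  by rewrite /cross /cmul /=; ring.
(* Scaling the momentum changes the energy at the nonzero rate |p|^2, which isolates a. *)
split=> //; have := H (0, X.2).
rewrite b0 mul0r addr0 lifted_energy_diff// => /eqP.
by rewrite mulf_eq0 (negPf P0) orbF => /eqP.
Qed.

(** Rotating b by 2 d turns a x b into cos(2d) (a x b) + sin(2d) (a . b), and the two products
    cannot both vanish. The angle is doubled because b will be the square of the free momentum; d <
    1 gives 2 d < 2, where the sine is positive. *)
Lemma rotation_cross (a b : plane R) (d : R) : a != 0 -> b != 0 -> 0 < d < 1 ->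
  exists2 t, t = 0 \/ t = d &
    cross a (cmul (cmul (cos t, sin t) (cos t, sin t)) b) != 0.
Proof.
move=> a0 b0 /andP[d0 d1]; have [e|ne] := eqVneq (cross a b) 0; last first.
  by exists 0; [left|rewrite cos0 sin0 !cmul1].
exists d; first by right.
have -> : cross a (cmul (cmul (cos d, sin d) (cos d, sin d)) b) =
    cos (d *+ 2) * cross a b + sin (d *+ 2) * dot a b.
  rewrite cos_mulr2n sin_mulr2n; have := cos2Dsin2 d.
  rewrite /cross /dot /cmul /=; move: (cos d) (sin d) => c s cs.
  have {cs} cs : s ^+ 2 = 1 - c ^+ 2 by lra.
  by ring: cs.
rewrite e mulr0 add0r mulf_neq0//.
  by rewrite gt_eqF// sin2_gt0//; lra.
apply/eqP => e'; have : dot a a * dot b b = 0.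
  transitivity (cross a b ^+ 2 + dot a b ^+ 2).
    by rewrite /cross /dot; ring.
  by rewrite e e' expr0n addr0.
by move=> /eqP; rewrite mulf_eq0 !dot_eq0 (negPf a0) (negPf b0).
Qed.

(* The second difference of a complex quadratic polynomial in h is twice its
   leading coefficient, so the polynomial cannot vanish at 0, h and 2 h. *)
Lemma quadratic_nonzero (z c kappa : plane R) (h : R) : z != 0 -> h != 0 ->
  exists2 t, [\/ t = 0, t = h | t = h + h] &
    cmul ((1 + t) *: z - c) ((1 + t) *: z - c) - kappa != 0.
Proof.
move=> z0 h0; pose f t := cmul ((1 + t) *: z - c) ((1 + t) *: z - c) - kappa.
have [f0|] := eqVneq (f 0) 0; last by exists 0 => //; constructor 1.
have [f1|] := eqVneq (f h) 0; last by exists h => //; constructor 2.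
have [f2|] := eqVneq (f (h + h)) 0; last by exists (h + h) => //; constructor 3.
have : (2 * h ^+ 2) *: cmul z z = f 0 - 2 *: f h + f (h + h).
  rewrite /f /cmul /=; case: (z) (c) (kappa) => [? ?] [? ?] [? ?].
  by rewrite /= /GRing.scale /=; congr pair; rewrite /= /GRing.scale /=; ring.
rewrite f0 f1 f2 scaler0 subrr addr0 => /eqP.
by rewrite scaler_eq0 mulf_eq0 pnatr_eq0 expf_eq0 (negPf h0) (negPf (cmul_neq0 z0 z0)).
Qed.

Lemma joachimsthal_first_integral m x y p r q : (0 < m)%N -> 0 < p -> 0 < q ->
  (forall s, ellipse x y p r q s != 0) ->
  first_integral (force_function m.+1) 0 m.+1 (ellipse x y p r q)
    (joachimsthal m x y p r q).
Proof.
move=> m0 p0 q0 g0; split.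
- exact/elementary_smooth/joachimsthal_elementary.
- exact: joachimsthal_motion.
- exact: joachimsthal_reflections.
move=> X SX B /(@flow_turn_cvg m X) [[/= U V] [/nbhs_ballP[e /= e0 eU]
  /nbhs_ballP[e' /= e'0 eV]] UV].
have [z0 _] := SX.
(* The dilation may go up to 2 h, which must stay below e; d <= 1/2 meets the condition d < 1 on
   rotations. *)
pose h := Num.min (e / 3) (1 / 3); pose d := Num.min (e' / 2) (1 / 2).
have h0 : 0 < h by rewrite lt_min !divr_gt0.
have d0 : 0 < d by rewrite lt_min !divr_gt0.
have he : h <= e / 3 by rewrite ge_min lexx.
have de : d <= e' / 2 by rewrite ge_min lexx.
have d1 : d <= 1 / 2 by rewrite ge_min lexx orbT.
(* The points to leave are the foci, the roots z of (z - c)^2 = A^2 + B^2 with A = (p, r) and B =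
   (0, q). As the dilation does not alter the free momentum, the angle can be chosen afterwards. *)
have [t tE t0] := quadratic_nonzero (x, y)
  (cmul (p, r) (p, r) + cmul (0, q) (0, q)) z0 (lt0r_neq0 h0).
have w0 : free_momentum m X != 0.
  have [_ e0'] := SX; apply: cmul_neq0; last first.
    by have := cpow_neq0 m z0; rewrite -!dot_eq0 /dot /cconj /= mulrNN.
  apply/eqP => P0; move/eqP: e0'; rewrite lifted_energyE// P0 /dot /= !mulr0.
  rewrite addr0 mul0r sub0r oppr_eq0 invr_eq0 expf_eq0.
  by rewrite -/(dot X.1 X.1) dot_eq0 (negPf z0) andbF.
have [|a aE a0] := rotation_cross t0 (cmul_neq0 w0 w0) (_ : 0 < d < 1).
  by apply/andP; split=> //; lra.
have t1 : 0 <= t < e by case: tE => ->; lra.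
have a1 : 0 <= a < e' by case: aE => ->; lra.
exists (flow_turn m X (t, a)); split; last first.
  apply: UV; split=> /=; [apply: eU|apply: eV];
    by rewrite /ball /= sub0r normrN ger0_norm; lra.
have t2 : 0 < 1 + t by lra.
have S : energy_surface (force_function m.+1) 0 m.+1 (flow_turn m X (t, a)).
  exact: flow_turn_surface.
split=> //; apply: joachimsthal_independent => //.
by rewrite flow_turn_momentum// -cmulACA.
Qed.

End Density.

(** * Families of walls *)

Section Families.
Context {R : realType}.
Implicit Types (k m : nat) (x y p r q s t : R) (z w : plane R).

Lemma ellipse_integrable_wall m x y p r q : (0 < m)%N -> 0 < p -> 0 < q ->
  (forall s, ellipse x y p r q s != 0) ->
  integrable_wall (force_function m.+1) 0 m.+1 (cpow m.+1 \o ellipse x y p r q).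
Proof.
move=> m0 p0 q0 g0; exists (ellipse x y p r q); split=> //; last first.
  by exists (joachimsthal m x y p r q); exact: joachimsthal_first_integral.
split.
- have ecst (c : R) : elementary (fun u : R => c) by exact: elementary_cst.
  have eid : elementary (fun u : R => u).
    exact: (elementary_linear (@is_diff_id R R)).
  exact/elementary2_smooth/(elementary2_ellipse (ecst x) (ecst y) (ecst p)
    (ecst r) (ecst q) eid).
- move=> s; rewrite (@derive_val _ _ _ _ _ _ _ (is_derive_ellipse x y p r q s)).
  exact: ellipse_velocity_neq0.
- left; exists (pi *+ 2); first by rewrite pmulrn_lgt0// pi_gt0.
  by move=> s; rewrite /ellipse cosD2pi sinD2pi.
Qed.

(* The absolute values and quotients are unfolded into positivity conditions,
   which are clearly open: |y| < t x and |(p, r, q)| < t |(x, y)|. *)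
Definition thin t x y p r q : Prop :=
  [/\ 0 < x, 0 < t * x - y & 0 < t * x + y] /\
  [/\ 0 < p, 0 < q & 0 < t ^+ 2 * (x ^+ 2 + y ^+ 2) - (p ^+ 2 + r ^+ 2 + q ^+ 2)].

(** Each coordinate moves by at most t |(x, y)| <= 2 t x away from the center. So the abscissa is at
    least x - 2 t x and the ordinate at most 3 t x in absolute value, and 3 t x <= 4 t (x - 2 t x)
    is exactly t <= 1/8. *)
Lemma thin_cone t x y p r q s : 0 < t <= 1 / 8 -> thin t x y p r q ->
  cone (4 * t) (ellipse x y p r q s).
Proof.
move=> /andP[t0 t8] [[x0 y1 y2] [p0 q0 h]].
have cs := cos2Dsin2 s; rewrite /cone /ellipse /=.
have tx : 0 < t * x by exact: mulr_gt0.
have tx8 : t * x <= x / 8 by rewrite mulrC ler_wpM2l ?(ltW x0)// -[8^-1]mul1r.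
have y2x : y ^+ 2 <= (t * x) ^+ 2.
  by rewrite -(real_normK (num_real y)) ler_pXn2r ?nnegrE ?(ltW tx)// ler_norml; lra.
have bnd (u : R) : u ^+ 2 <= p ^+ 2 + r ^+ 2 + q ^+ 2 -> `|u| <= 2 * (t * x).
  move=> hu; rewrite -(ler_pXn2r (ltn0Sn 1)) ?nnegrE//; last by lra.
  rewrite real_normK ?num_real//; apply: (le_trans hu).
  have : (t * x) ^+ 2 <= x ^+ 2.
    by rewrite ler_pXn2r ?nnegrE ?(ltW tx) ?(ltW x0)//; lra.
  move=> txx; have yx : y ^+ 2 <= x ^+ 2 by exact: le_trans txx.
  have : t ^+ 2 * y ^+ 2 <= t ^+ 2 * x ^+ 2 by rewrite ler_wpM2l// sqr_ge0.
  by rewrite !exprMn; have := sqr_ge0 (t * x); rewrite exprMn; lra.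
have h1 : `|p * cos s| <= 2 * (t * x).
  apply: bnd; rewrite exprMn.
  have : 0 <= p ^+ 2 * sin s ^+ 2 by rewrite mulr_ge0 ?sqr_ge0.
  have -> : sin s ^+ 2 = 1 - cos s ^+ 2 by lra.
  by have := sqr_ge0 r; have := sqr_ge0 q; lra.
have h2 : `|r * cos s + q * sin s| <= 2 * (t * x).
  apply: bnd.
  have : 0 <= (r * sin s - q * cos s) ^+ 2 by exact: sqr_ge0.
  have -> : (r * sin s - q * cos s) ^+ 2 =
    (r ^+ 2 + q ^+ 2) * (cos s ^+ 2 + sin s ^+ 2) - (r * cos s + q * sin s) ^+ 2 by ring.
  by rewrite cs; have := sqr_ge0 p; lra.
move: h1 h2; rewrite !ler_norml => /andP[h1 h1'] /andP[h2 h2'].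
split; first by lra.
have : t * (x - 2 * (t * x)) <= t * (x + p * cos s) by apply: ler_wpM2l; [exact: ltW|lra].
have : t * (t * x) <= t * x / 8 by rewrite mulrC ler_wpM2l ?(ltW tx)// -[8^-1]mul1r.
by move=> ? ?; apply/andP; split; lra.
Qed.

(* Small enough for the products of two points of the sector of slope
   4 * aperture k to lie in the sector of [cpow_inj_cone]. *)
Definition aperture k : R := (2 * k%:R + 2)^-1 / 16.

Lemma aperture_bound k : 0 < aperture k <= 1 / 32.
Proof.
have k0 := ler0n R k; have K : 0 < 2 * k%:R + 2 :> R by lra.
rewrite divr_gt0 ?invr_gt0//=; have : (2 * k%:R + 2)^-1 <= 2^-1 :> R.
  by rewrite lef_pV2 ?posrE//; lra.
by rewrite /aperture; lra.
Qed.

Lemma cpow_inj_cone2 k z z' w w' : (0 < k)%N ->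
  cone (4 * aperture k) z -> cone (4 * aperture k) z' ->
  cone (4 * aperture k) w -> cone (4 * aperture k) w' ->
  cpow k (cmul z z') = cpow k (cmul w w') -> cmul z z' = cmul w w'.
Proof.
move=> k0 cz cz' cw cw'; have /andP[a0 a1] := aperture_bound k.
have aE : (2 * k%:R + 2)^-1 = 16 * aperture k by rewrite /aperture; lra.
have M u v : cone (4 * aperture k) u -> cone (4 * aperture k) v ->
    cone (2 * k%:R + 2)^-1 (cmul u v).
  rewrite aE; apply: cone_mul; [lra|lra|lra| |].
    have : 4 * aperture k * (4 * aperture k) <= 1 / 8 * (1 / 8) by apply: ler_pM; lra.
    by lra.
  have : aperture k * (4 * aperture k * (4 * aperture k)) <= aperture k * (1 / 8 * (1 / 8)).
    by rewrite ler_wpM2l ?(ltW a0)//; apply: ler_pM; lra.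
  by lra.
by apply: cpow_inj_cone => //; exact: M.
Qed.

(** Let E(0) correspond to E'(s0) and E(s) to E'(s'). Eliminating c gives (E(0) E'(s'))^k = (E'(s0)
    E(s))^k, and injectivity on products removes the power. The quotient E'(s0) / E(0) is therefore
    one k-th root of c valid along the whole ellipse. *)
Lemma thin_wall_similar k (c : plane R) x y p r q x' y' p' r' q' : (0 < k)%N ->
  thin (aperture k) x y p r q -> thin (aperture k) x' y' p' r' q' ->
  range (cpow k \o ellipse x' y' p' r' q') =
    cmul c @` range (cpow k \o ellipse x y p r q) ->
  exists lambda,
    range (ellipse x' y' p' r' q') = cmul lambda @` range (ellipse x y p r q).
Proof.
move=> k0 th th' e.
set E := ellipse x y p r q in th e *; set E' := ellipse x' y' p' r' q' in th' e *.
have /andP[a0 a1] := aperture_bound k.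
have a8 : 0 < aperture k <= 1 / 8 by apply/andP; split=> //; lra.
have cE s : cone (4 * aperture k) (E s) by exact: thin_cone.
have cE' s : cone (4 * aperture k) (E' s) by exact: thin_cone.
have H s : exists s', cmul c (cpow k (E s)) = cpow k (E' s').
  have : (cmul c @` range (cpow k \o E)) (cmul c (cpow k (E s))).
    by exists (cpow k (E s)) => //; exists s.
  by rewrite -e => -[s' _ <-]; exists s'.
have H' s : exists s', cpow k (E' s) = cmul c (cpow k (E s')).
  have : range (cpow k \o E') (cpow k (E' s)) by exists s.
  by rewrite e => -[_ [s' _ <-] <-]; exists s'.
have [s0 e0] := H 0; have z0 := cone_neq0 (cE 0).
pose lambda := cmul (E' s0) (cinv (E 0)); exists lambda.
have key s s' : cmul c (cpow k (E s)) = cpow k (E' s') -> E' s' = cmul lambda (E s).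
  move=> e1; apply: (cmul_inj z0).
  have -> : cmul (E 0) (cmul lambda (E s)) = cmul (E' s0) (E s).
    by rewrite /lambda (cmulC (E' s0)) !cmulA cmulV// cmul1.
  apply: (cpow_inj_cone2 k0) => //.
  by rewrite !cpow_mul -e0 -e1 !cmulA [cmul (cpow k (E 0)) c]cmulC.
apply/seteqP; split => [_ [s _ <-]|_ [_ [s _ <-] <-]].
  by have [s' e1] := H' s; exists (E s'); [exists s'|rewrite (key s' s)].
by have [s' e1] := H s; exists s' => //; exact: key.
Qed.

Lemma similitudeE (rho theta : R) z :
  similitude rho theta z = cmul (rho *: (cos theta, sin theta)) z.
Proof.
by rewrite /similitude /cmul /= /GRing.scale /=; congr pair; rewrite /= /GRing.scale /=; ring.
Qed.

Lemma thin_wall_inj k x y p r q x' y' p' r' q' : (0 < k)%N ->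
  thin (aperture k) x y p r q -> thin (aperture k) x' y' p' r' q' ->
  range (cpow k \o ellipse x y p r q) = range (cpow k \o ellipse x' y' p' r' q') ->
  [/\ x = x', y = y', p = p', r = r' & q = q'].
Proof.
move=> k0 th th' e; have [_ [p0 q0 _]] := th; have [_ [p'0 q'0 _]] := th'.
apply: ellipse_range_inj => //; have /andP[a0 a1] := aperture_bound k.
have a8 : 0 < aperture k <= 1 / 8 by apply/andP; split=> //; lra.
have sub s : cone (2 * k%:R + 2)^-1 (ellipse x y p r q s).
  by apply: cone_sub (thin_cone s a8 th); rewrite /aperture in a0 *; lra.
have sub' s : cone (2 * k%:R + 2)^-1 (ellipse x' y' p' r' q' s).
  by apply: cone_sub (thin_cone s a8 th'); rewrite /aperture in a0 *; lra.
apply/seteqP; split => _ [s _ <-].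
  have : range (cpow k \o ellipse x y p r q) (cpow k (ellipse x y p r q s)) by exists s.
  by rewrite e => -[s' _ e']; exists s' => //; exact: cpow_inj_cone e'.
have : range (cpow k \o ellipse x' y' p' r' q') (cpow k (ellipse x' y' p' r' q' s)).
  by exists s.
by rewrite -e => -[s' _ e']; exists s' => //; exact: cpow_inj_cone e'.
Qed.

(** The factor [lambda] carries the center 1 of the first ellipse to [lambda], while the second
    ellipse is centered at 1; uniqueness of the center forces [lambda] to be 1. *)
Lemma centered_wall_inj k p r q p' r' q' : (0 < k)%N ->
  thin (aperture k) 1 0 p r q -> thin (aperture k) 1 0 p' r' q' ->
  same_up_to_similitude (range (cpow k \o ellipse 1 0 p r q))
    (range (cpow k \o ellipse 1 0 p' r' q')) ->
  [/\ p = p', r = r' & q = q'].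
Proof.
move=> k0 th th' [rho [theta [rho0 e]]].
have {}e : range (cpow k \o ellipse 1 0 p' r' q') =
    cmul (rho *: (cos theta, sin theta)) @` range (cpow k \o ellipse 1 0 p r q).
  rewrite e; congr (_ @` _); apply/funext => z; exact: similitudeE.
have [lambda el] := thin_wall_similar k0 th th' e.
have [_ [p0 q0 _]] := th; have [_ [p'0 q'0 _]] := th'.
have l1 : lambda = (1, 0).
  apply: (@ellipse_center_uniq R 1 0 p' r' q') => // s.
  have : range (ellipse 1 0 p' r' q') (ellipse 1 0 p' r' q' s) by exists s.
  rewrite el => -[_ [s' _ <-] <-].
  have : (cmul lambda @` range (ellipse 1 0 p r q))
      (cmul lambda (ellipse 1 0 p r q (s' + pi))).
    by exists (ellipse 1 0 p r q (s' + pi)) => //; exists (s' + pi).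
  rewrite -el => -[s'' _ e']; exists s''; rewrite e' /ellipse cosDpi sinDpi.
  by rewrite /cmul /= /GRing.scale /=; congr pair; rewrite /= /GRing.scale /=; ring.
have [|_ _ -> -> ->] := @ellipse_range_inj R 1 0 p' r' q' 1 0 p r q p'0 q'0 p0 q0.
  rewrite el l1; apply/seteqP; split=> [_ [z zE <-]|z zE]; first by rewrite cmul1.
  by exists z; rewrite // cmul1.
by [].
Qed.

(** Dividing by the center c divides the sum of squares of the semi-axes by |c|^2, so the size
    condition of [thin] survives, and the orthogonal factor of the normal form does not change that
    sum. In the q-plane the factor becomes c^k. *)
Lemma thin_wall_normalize k x y p r q : thin (aperture k) x y p r q ->
  exists p' r' q', thin (aperture k) 1 0 p' r' q' /\
    same_up_to_similitude (range (cpow k \o ellipse 1 0 p' r' q'))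
      (range (cpow k \o ellipse x y p r q)).
Proof.
move=> [[x0 y1 y2] [p0 q0 h]]; have /andP[a0 a1] := aperture_bound k.
pose c : plane R := (x, y).
have c0 : c != 0 by apply/eqP => -[xE _]; rewrite xE ltxx in x0.
have n0 : 0 < dot c c by rewrite dot_gt0.
have nE : dot c c = x ^+ 2 + y ^+ 2 by rewrite /dot /= !expr2.
pose u := cmul (cinv c) (p, r); pose v := cmul (cinv c) (0, q).
have iE : dot (cinv c) (cinv c) = (dot c c)^-1.
  transitivity ((dot c c)^-1 * ((dot c c)^-1 * dot c c)).
    by rewrite {1}/dot /cinv /= /dot /=; ring.
  by rewrite mulVf ?gt_eqF// mulr1.
have [|p' [r' [q' [phi [p'0 q'0 n' E]]]]] :=
    @ellipse_normal_form R u.1 v.1 u.2 v.2.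
  (* Multiplication by 1/c scales areas by |c|^(-2), so the determinant of the semi-axes stays
     positive. *)
  have -> : u.1 * v.2 - v.1 * u.2 = dot (cinv c) (cinv c) * (p * q).
    by rewrite /u /v /cmul /dot /=; ring.
  by rewrite iE mulr_gt0 ?invr_gt0// mulr_gt0.
exists p', r', q'; split.
  split; first by split; lra.
  split=> //; rewrite n'.
  have -> : u.1 ^+ 2 + v.1 ^+ 2 + u.2 ^+ 2 + v.2 ^+ 2 =
      dot (cinv c) (cinv c) * (p ^+ 2 + r ^+ 2 + q ^+ 2).
    by rewrite /u /v /cmul /dot /=; ring.
  rewrite iE expr0n addr0 expr1n mulr1 subr_gt0 mulrC ltr_pdivrMr//.
  by rewrite nE -subr_gt0.
have F s : ellipse x y p r q s = cmul c (ellipse 1 0 p' r' q' (s - phi)).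
  have [E1 E2] := E s; rewrite /ellipse -E1 add0r -E2.
  have -> : (1 + (u.1 * cos s + v.1 * sin s), u.2 * cos s + v.2 * sin s) =
      (1, 0) + (cos s *: u + sin s *: v) :> plane R.
    by congr pair; rewrite /= /GRing.scale /=; ring.
  have cu : cmul c u = (p, r) by rewrite /u cmulA cmulV// cmul1.
  have cv : cmul c v = (0, q) by rewrite /v cmulA cmulV// cmul1.
  have cZ (b : R) w : cmul c (b *: w) = b *: cmul c w.
    by rewrite /cmul /= /GRing.scale /=; congr pair; rewrite /= /GRing.scale /=; ring.
  rewrite !cmulDr !cZ cu cv [cmul c (1, 0)]cmulC cmul1.
  by congr pair; rewrite /= /GRing.scale /=; ring.
have [rho [theta [rho0 ck]]] := polar_form (cpow_neq0 k c0).
exists rho, theta; split=> //; apply/seteqP; split=> [_ [s _ <-]|_ [_ [s _ <-] <-]].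
  exists (cpow k (ellipse 1 0 p' r' q' (s - phi))); first by exists (s - phi).
  by rewrite similitudeE -ck -cpow_mul -F.
by exists (s + phi) => //; rewrite similitudeE -ck -cpow_mul /= F addrK.
Qed.

End Families.

(** * Openness of the parameter domains and smoothness of the families *)

Section FamilyRegularity.
Context {R : realType} {V : normedModType R} (x y p r q : V -> R).
Context (elx : elementary x) (ely : elementary y) (elp : elementary p)
  (elr : elementary r) (elq : elementary q).

Lemma elementary_fst (W : normedModType R) (f : V -> R) :
  elementary f -> elementary (fun u : V * W => f u.1).
Proof.
elim=> {f} [c|f hf|f g _ hf _ hg|f g _ hf _ hg|f _ hf|f _ hf].
- exact: elementary_cst.
- by apply: elementary_linear => u; exact: (is_diff_comp (is_diff_fst u) (hf _)).
- exact: elementaryD.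
- exact: elementaryM.
- exact: elementary_cos.
- exact: elementary_sin.
Qed.

Lemma elementary_open_gt0 (f : V -> R) : elementary f -> open [set a | 0 < f a].
Proof.
move=> ef; apply: (@open_comp _ _ f [set u : R | 0 < u]); last exact: open_gt.
by move=> a _; exact/differentiable_continuous/elementary_differentiable.
Qed.

Lemma thin_open t : open [set a | thin t (x a) (y a) (p a) (r a) (q a)].
Proof.
have et : elementary (fun _ : V => t) by exact: elementary_cst.
rewrite (_ : [set a | _] =
  ([set a | 0 < x a] `&` [set a | 0 < t * x a - y a] `&`
   [set a | 0 < t * x a + y a]) `&`
  ([set a | 0 < p a] `&` [set a | 0 < q a] `&`
   [set a | 0 < t ^+ 2 * (x a ^+ 2 + y a ^+ 2) - (p a ^+ 2 + r a ^+ 2 + q a ^+ 2)])).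
  do 5?apply: openI; apply: elementary_open_gt0 => //.
  - by apply: elementaryB => //; exact: elementaryM.
  - by apply: elementaryD => //; exact: elementaryM.
  - apply: elementaryB.
      apply: elementaryM; first exact: elementaryX.
      by apply: elementaryD; exact: elementaryX.
    by do 2?apply: elementaryD; exact: elementaryX.
by apply/seteqP; split=> a /=; [case=> -[? ? ?] [? ? ?]|case=> -[[? ?] ?] [[? ?] ?]].
Qed.

Lemma wall_smooth k (O : set (V * R)) : smooth O (fun u : V * R =>
  (cpow k \o ellipse (x u.1) (y u.1) (p u.1) (r u.1) (q u.1)) u.2).
Proof.
apply: elementary2_smooth; apply: elementary2_cpow.
have es : elementary (fun u : V * R => u.2) := elementary_linear (@is_diff_snd R V R).
exact: (elementary2_ellipse (elementary_fst R elx) (elementary_fst R ely)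
  (elementary_fst R elp) (elementary_fst R elr) (elementary_fst R elq) es).
Qed.

End FamilyRegularity.

Lemma thin_integrable_wall (R : realType) m (x y p r q : R) : (0 < m)%N ->
  thin (aperture m.+1) x y p r q ->
  integrable_wall (force_function m.+1) 0 m.+1 (cpow m.+1 \o ellipse x y p r q).
Proof.
move=> m0 th; have [_ [p0 q0 _]] := th; apply: ellipse_integrable_wall => // s.
have /andP[a0 a1] := @aperture_bound R m.+1.
apply: cone_neq0; apply: thin_cone th.
by apply/andP; split=> //; lra.
Qed.

Lemma rV_inord_ext (R : realType) n (a b : 'rV[R]_n.+1) :
  (forall i, (i <= n)%N -> a ord0 (inord i) = b ord0 (inord i)) -> a = b.
Proof. by move=> h; apply/rowP => i; rewrite -(inord_val i); apply: h; rewrite -ltnS. Qed.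

Unset Implicit Arguments.

Theorem proposition1 (R : realType) (k : nat) (hk : (2 <= k)%N) :
  exists (P : set 'rV[R]_5) (B : 'rV[R]_5 -> R -> R * R)
         (Q : set 'rV[R]_3) (D : 'rV[R]_3 -> R -> R * R),
    [/\ wall_family (force_function k) 0 k eq P B,
        wall_family (force_function k) 0 k same_up_to_similitude Q D,
        (forall b, Q b -> exists2 a, P a & range (D b) = range (B a)) &
        (forall a, P a -> exists2 b, Q b & same_up_to_similitude (range (D b)) (range (B a)))].
Proof.
case: k hk => [|m] // m0.
have /andP[] := @aperture_bound R m.+1; set t := aperture _ => t0 _.
pose P := [set a : 'rV[R]_5 | thin t (a ord0 (inord 0)) (a ord0 (inord 1))
  (a ord0 (inord 2)) (a ord0 (inord 3)) (a ord0 (inord 4))].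
pose B (a : 'rV[R]_5) := cpow m.+1 \o
  ellipse (a ord0 (inord 0)) (a ord0 (inord 1)) (a ord0 (inord 2))
          (a ord0 (inord 3)) (a ord0 (inord 4)).
pose Q := [set b : 'rV[R]_3 |
  thin t 1 0 (b ord0 (inord 0)) (b ord0 (inord 1)) (b ord0 (inord 2))].
pose D (b : 'rV[R]_3) := cpow m.+1 \o
  ellipse 1 0 (b ord0 (inord 0)) (b ord0 (inord 1)) (b ord0 (inord 2)).
pose row n (s : seq R) : 'rV[R]_n.+1 := \row_i s`_i.
have rowE n s i : (i <= n)%N -> row n s ord0 (inord i) = s`_i.
  by move=> ni; rewrite mxE inordK.
have QP b : Q b -> exists2 a, P a & range (D b) = range (B a).
  move=> Qb; exists (row 4 [:: 1; 0; b ord0 (inord 0); b ord0 (inord 1); b ord0 (inord 2)]).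
    by rewrite /P /= !rowE.
  by rewrite /B !rowE.
have coord n i : elementary (fun a : 'rV[R]_n => a ord0 i).
  by apply: elementary_linear => a; exact: is_diff_coord.
have cst (c : R) : elementary (fun _ : 'rV[R]_3 => c) by exact: elementary_cst.
(* The circle of radius t / 2 about 1, thin because 2 (t / 2)^2 < t^2; it witnesses that both
   domains are nonempty. *)
have Q0 : Q (row 2 [:: t / 2; 0; t / 2]).
  rewrite /Q /= !rowE//=; split; split; rewrite ?divr_gt0//; [lra|lra|].
  by have : 0 < t ^+ 2 by [rewrite exprn_gt0]; lra.
exists P, B, Q, D; split=> //.
- split.
  + by split; [exact: thin_open|have [a Pa _] := QP _ Q0; exists a].
  + exact: (wall_smooth (coord _ _) (coord _ _) (coord _ _) (coord _ _) (coord _ _)).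
  + by move=> a Pa; exact: (thin_integrable_wall m0 Pa).
  + move=> a b Pa Pb e.
    have [e0 e1 e2 e3 e4] := thin_wall_inj (ltn0Sn m) Pa Pb e.
    by apply: rV_inord_ext => -[|[|[|[|[|//]]]]].
- split.
  + by split; [exact: thin_open|exists (row 2 [:: t / 2; 0; t / 2])].
  + exact: (wall_smooth (cst 1) (cst 0) (coord _ _) (coord _ _) (coord _ _)).
  + by move=> b Qb; exact: (thin_integrable_wall m0 Qb).
  + move=> a b Qa Qb e.
    have [e0 e1 e2] := centered_wall_inj (ltn0Sn m) Qa Qb e.
    by apply: rV_inord_ext => -[|[|[|//]]].
- move=> a Pa; have [p [r [q [th e]]]] := thin_wall_normalize Pa.
  by exists (row 2 [:: p; r; q]); rewrite ?/Q ?/D /= !rowE.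
Qed.
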